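(* Let $t \ge 1$ be an integer, and let $G$ be a finite connected graph of girth $g \ge 4t+1$ and with minimum degree $\delta$. Then $c(G) > \frac{1}{e\,t}(\delta-1)^{t}$, where $c(G)$ is the cop number of $G$ and $e$ is the base of the natural logarithm.
   Context: The game of cops and robbers is played with perfect information on a finite connected (undirected) graph $G$. The first player controls a team of cops, the second player controls one robber. First the first player places each cop on a vertex (several cops may share a vertex), then the second player places the robber on a vertex. The players then alternate turns, the first player moving first. On her turn the first player moves each cop to a vertex of its closed neighborhood (each cop may stay put or move to an adjacent vertex); on his turn the second player moves the robber to a vertex of the closed neighborhood of its current vertex. The first player wins if at some point a cop occupies the same vertex as the robber; the second player wins if the robber avoids this forever. The cop number $c(G)$ is the smallest number of cops for which the first player has a winning strategy on $G$. The girth of a graph is the length of its shortest cycle. *)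

(* Defs.v *)
From mathcomp Require Import all_boot all_order all_algebra.
From mathcomp Require Import all_classical all_reals all_analysis.

Set Implicit Arguments.
Unset Strict Implicit.
Unset Printing Implicit Defensive.

Import Order.TTheory GRing.Theory Num.Theory.

Local Open Scope classical_set_scope.
Local Open Scope nat_scope.

(* A simple graph on T is given by a symmetric irreflexive adjacency relation. *)

Definition graph_connected (T : finType) (adj : rel T) : Prop :=
  0 < #|T| /\ forall x y : T, connect adj x y.

Definition degree (T : finType) (adj : rel T) (x : T) : nat :=
  #|[pred y | adj x y]|.

(* The default value #|T| plays no role on a nonempty graph, since every degree
   is at most #|T|. *)
Definition min_degree (T : finType) (adj : rel T) : nat :=
  \big[minn/#|T|]_(x : T) degree adj x.

(* The condition on the size excludes the degenerate cycles [::], [:: x] and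
   [:: x; y], the last of which would traverse one edge back and forth. *)
Definition graph_cycle (T : finType) (adj : rel T) (p : seq T) : Prop :=
  2 < size p /\ ucycle adj p.

(* Extended-real valued, so that an acyclic graph has girth +oo. *)
Definition girth (R : realType) (T : finType) (adj : rel T) : \bar R :=
  ereal_inf [set ((size p)%:R%R)%:E | p in [set p | graph_cycle adj p]].

Definition closed_nbhd (T : finType) (adj : rel T) (x : T) : pred T :=
  [pred y | (y == x) || adj x y].

(* A strategy for k cops: the cops' positions as a function of the list of all
   robber positions so far, oldest first; the cops' own past positions are
   determined by that list.  The initial placement is [sigma [::]]; the
   placement after the cops have answered r_0, ..., r_n is
   [sigma [:: r_0; ...; r_n]]. *)
Definition cop_strategy (T : finType) (k : nat) : Type :=
  seq T -> {ffun 'I_k -> T}.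

Definition legal_strategy (T : finType) (adj : rel T) (k : nat)
    (sigma : cop_strategy T k) : Prop :=
  forall (h : seq T) (r : T) (i : 'I_k),
    sigma (rcons h r) i \in closed_nbhd adj (sigma h i).

Definition robber_walk (T : finType) (adj : rel T) (rho : nat -> T) : Prop :=
  forall n : nat, rho n.+1 \in closed_nbhd adj (rho n).

Definition occupied (T : finType) (k : nat) (c : {ffun 'I_k -> T}) (r : T) :
    Prop :=
  exists i : 'I_k, c i = r.

(* [mkseq rho n] is [:: rho 0; ...; rho n.-1].  The robber is caught in round n
   either by arriving at rho n, where a cop already stands, or by the cops'
   answer to that move. *)
Definition caught (T : finType) (k : nat) (sigma : cop_strategy T k)
    (rho : nat -> T) (n : nat) : Prop :=
  occupied (sigma (mkseq rho n)) (rho n) \/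
  occupied (sigma (mkseq rho n.+1)) (rho n).

Definition winning_strategy (T : finType) (adj : rel T) (k : nat)
    (sigma : cop_strategy T k) : Prop :=
  legal_strategy adj sigma /\
  forall rho : nat -> T, robber_walk adj rho -> exists n, caught sigma rho n.

Definition cops_win (T : finType) (adj : rel T) (k : nat) : Prop :=
  exists sigma : cop_strategy T k, winning_strategy adj sigma.

Lemma cops_win_ex (T : finType) (adj : rel T) :
  exists k, `[< cops_win adj k >].
Proof.
exists #|T|; apply/asboolP.
exists (fun=> [ffun i => enum_val i]); split=> [h r i|rho _].
  by rewrite inE eqxx.
by exists 0; left; exists (enum_rank (rho 0)); rewrite ffunE enum_rankK.
Qed.

Definition cop_number (T : finType) (adj : rel T) : nat :=
  ex_minn (cops_win_ex adj).

(* Main.v *)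
(* Let q = delta - 1, rho = (t - 1) / t and B = rho * q.  When the robber has
   just moved from u to v, a cop reached from v by a non-backtracking walk of
   length m < 2t whose first step is not back to u is given weight B^-floor(m/2).
   Girth > 4t makes the first step of such a walk unique, so in the next round
   a cop threatens at most one of the robber's (at least q) onward moves, and
   there its weight has grown by a factor of at most B, or else is the least
   weight B^-(t - 1).  Averaging over the onward moves, the robber can pass
   from total weight D to at most rho * D + k * B^-(t - 1) / q.  Since
   rho^(t - 1) > 1 / e, this stays below 1 whenever k <= q^t / (e * t), while
   any cop able to catch the robber has weight 1. *)
Require Import Defs.
From mathcomp Require Import all_boot all_order all_algebra.
From mathcomp Require Import all_classical all_reals all_analysis.
From mathcomp Require Import zify ring lra.

Set Implicit Arguments.
Unset Strict Implicit.
Unset Printing Implicit Defensive.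

Import Order.TTheory GRing.Theory Num.Theory.

Local Open Scope ring_scope.

(** * Non-backtracking walks in a graph of large girth *)

Section NonBacktrackingWalks.
Variables (T : finType) (adj : rel T).

(* [u] is the vertex visited just before [x]. *)
Fixpoint nbwalk (u x : T) (p : seq T) : bool :=
  if p is y :: p' then [&& adj x y, y != u & nbwalk x y p'] else true.

Lemma nbwalk_path u x p : nbwalk u x p -> path adj x p.
Proof. by elim: p u x => //= y p IH u x /and3P[-> _ /IH]. Qed.

Lemma nbwalk_rcons u x p y :
  nbwalk u x (rcons p y) =
  [&& nbwalk u x p, adj (last x p) y & y != last u (belast x p)].
Proof.
elim: p u x => [|z p IH] u x /=; first by rewrite andbT.
by rewrite IH !andbA.
Qed.

(** The walk is kept, loses its last edge, or gains one. It must be nonempty because a move from [x]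
    itself could lead to [u]. *)
Lemma nbwalk_closed_nbhd (adj_sym : symmetric adj) u x p c :
  nbwalk u x p -> p != [::] -> last x p \in closed_nbhd adj c ->
  exists q, [/\ nbwalk u x q, last x q = c & (size q <= (size p).+1)%N].
Proof.
case/lastP: p => // p y; rewrite last_rcons size_rcons => Hp _.
rewrite inE => /orP[/eqP yc|cy].
  by exists (rcons p y); rewrite last_rcons size_rcons; split.
have [lc|lc] := eqVneq (last x p) c.
  exists p; split=> //; first by move: Hp; rewrite nbwalk_rcons => /and3P[].
  by rewrite leqW.
exists (rcons (rcons p y) c); rewrite last_rcons !size_rcons; split=> //.
rewrite nbwalk_rcons Hp last_rcons adj_sym cy /= belast_rcons /=.
by rewrite eq_sym.
Qed.

Section Girth.
Hypotheses (adj_sym : symmetric adj) (adj_irr : irreflexive adj).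
Variables (g : nat).
Hypothesis (long_cycles : forall p, graph_cycle adj p -> (g < size p)%N).

(** A return to [x] would close a cycle of length at most [g]; lengths 1 and 2 are excluded by
    irreflexivity and by non-backtracking. *)
Lemma nbwalk_uniq u x p : nbwalk u x p -> (size p <= g)%N -> uniq (x :: p).
Proof.
elim: p u x => // y p IH u x Hp szp.
have Ht : uniq (y :: p).
  by case/and3P: Hp => _ _ /IH; apply; apply: ltnW.
rewrite cons_uniq Ht andbT; apply/negP => xp.
case/splitPr: xp Hp Ht szp => p1 p2 Hp Ht szp.
have Hc : ucycle adj (x :: p1).
  move: Ht; rewrite cat_uniq /= => /and3P[u1]; rewrite negb_or => /andP[xp1 _] _.
  move: (nbwalk_path Hp); rewrite cat_path /= => /and3P[Hp1 l1 _].
  by apply/andP; split; rewrite /= ?xp1 // rcons_path Hp1.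
suff: (2 < size (x :: p1))%N.
  move=> s2; have := long_cycles (conj s2 Hc).
  by move: szp; rewrite size_cat /=; lia.
case: p1 Hp {Hc Ht szp} => [|a [|b p1]] //=; first by rewrite adj_irr.
by rewrite eqxx !andbF.
Qed.

(* The two walks run away from each other along the edge [a x], so reversing
   one and appending the other gives a single non-backtracking walk. *)
Lemma nbwalk_opposite a x p q :
  adj a x -> nbwalk a x q -> nbwalk x a p -> (size p + size q < g)%N ->
  last a p != last x q.
Proof.
elim: p a x q => [|b p IH] a x q ax Hq /= Hp sz.
  have : uniq (a :: x :: q).
    apply: (@nbwalk_uniq a) => //=; rewrite ax Hq andbT /=.
    by apply: contraTneq ax => ->; rewrite adj_irr.
  by rewrite cons_uniq => /andP[+ _]; apply: contraNneq => /= ->; apply: mem_last.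
case/and3P: Hp => ab bx Hp.
apply: (IH b a (x :: q)) => /=; rewrite ?[adj b a]adj_sym ?ax ?Hq ?andbT //.
  by rewrite eq_sym.
by move: sz => /=; lia.
Qed.

(** If [a] and [b] differed, [p] and [b :: q] would leave the edge between [a] and [v] in opposite
    directions. *)
Lemma nbwalk_branch v a b p q :
  adj v a -> adj v b -> nbwalk v a p -> nbwalk v b q ->
  (size p + size q + 2 <= g)%N -> last a p = last b q -> a = b.
Proof.
move=> va vb Hp Hq sz e; apply/eqP; apply: contra_eqT e => ab.
apply: (@nbwalk_opposite a v p (b :: q)) => //=; first by rewrite adj_sym.
  by rewrite vb Hq eq_sym ab.
by lia.
Qed.

End Girth.
End NonBacktrackingWalks.

(** * The weight of a single cop *)

Section Threat.
Variables (R : realType) (T : finType) (adj : rel T).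
Hypotheses (adj_sym : symmetric adj) (adj_irr : irreflexive adj).
Variables (t : nat).
Hypothesis (t_gt0 : (0 < t)%N).
Hypothesis (long_cycles : forall p, graph_cycle adj p -> (4 * t < size p)%N).
Variable (B : R).
Hypotheses (B_ge0 : 0 <= B) (B_ge1 : (1 < t)%N -> 1 <= B).

Definition nbreach (u v c : T) (n : nat) : bool :=
  `[< exists p, [/\ nbwalk adj u v p, last v p = c & size p = n] >].

(* [find] returns [2 * t] when no walk of length below [2 * t] exists.  For
   [t = 1] the base [B] may be 0, but then only [B ^- 0 = 1] occurs. *)
Definition threat (u v c : T) : R :=
  let m := find (nbreach u v c) (iota 0 (2 * t)) in
  if (m < 2 * t)%N then B ^- m./2 else 0.

Lemma threat_ge0 u v c : 0 <= threat u v c.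
Proof. by rewrite /threat; case: ifP => // _; rewrite invr_ge0 exprn_ge0. Qed.

Lemma threat_attained u v c : threat u v c != 0 ->
  exists p, [/\ nbwalk adj u v p, last v p = c, (size p < 2 * t)%N &
                threat u v c = B ^- (size p)./2].
Proof.
rewrite /threat; case: ifP => [lt_m _|_]; last by rewrite eqxx.
have : has (nbreach u v c) (iota 0 (2 * t)) by rewrite has_find size_iota.
move/(nth_find 0%N); rewrite nth_iota // add0n => /asboolP[p [Hp lp sp]].
by exists p; rewrite sp.
Qed.

Lemma le_weight (i j : nat) : (i <= j)%N -> (j < t)%N -> B ^- j <= B ^- i.
Proof.
move=> ij jt; have [t1|t1] := leqP t 1.
  by have [-> ->] : i = 0%N /\ j = 0%N by lia.
have B0 : 0 < B by apply: lt_le_trans (B_ge1 t1).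
by rewrite lef_pV2 ?posrE ?exprn_gt0 // ler_weXn2l ?B_ge1.
Qed.

(** [find] selects the shortest walk, and the weight does not increase with length. *)
Lemma threat_ge u v c p : nbwalk adj u v p -> last v p = c ->
  (size p < 2 * t)%N -> B ^- (size p)./2 <= threat u v c.
Proof.
move=> Hp lp sp.
have Hr : nbreach u v c (size p) by apply/asboolP; exists p.
have le_m : (find (nbreach u v c) (iota 0 (2 * t)) <= size p)%N.
  rewrite leqNgt; apply/negP => /(before_find 0%N).
  by rewrite nth_iota // add0n Hr.
rewrite /threat (leq_ltn_trans le_m sp); apply: le_weight; last by lia.
exact: half_leq.
Qed.

(** Lengths 0 and 1 both halve to exponent 0. A cop at [u] is excepted, since the step from [v] to
    [u] would backtrack. *)
Lemma threat_near u v c : u != c -> v \in closed_nbhd adj c ->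
  1 <= threat u v c.
Proof.
rewrite eq_sym => uc; rewrite inE => /orP[/eqP vc|cv].
  by have := @threat_ge u v c [::]; rewrite expr0 invr1; apply=> //=; lia.
have := @threat_ge u v c [:: c]; rewrite expr0 invr1; apply=> //=; last by lia.
by rewrite adj_sym cv uc.
Qed.

(** At most one [w] contributes. Prefixing [w] and undoing the cop's move lengthens its walk by at
    most two, which costs at most one factor [B]; walks too long for this already have weight
    [B ^- t.-1]. *)
Lemma threat_step u v c c' : adj u v -> c' \in closed_nbhd adj c ->
  \sum_(w | adj v w && (w != u)) threat v w c'
    <= B * threat u v c + B ^- t.-1.
Proof.
move=> uv cc'; case: (pickP (fun w => [&& adj v w, w != u & threat v w c' != 0]));
    last first.
  move=> none; rewrite big1 => [|w /andP[vw wu]].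
    by rewrite addr_ge0 ?mulr_ge0 ?threat_ge0 ?invr_ge0 ?exprn_ge0.
  by have := none w; rewrite vw wu /= => /negbFE/eqP.
move=> w /and3P[vw wu /threat_attained[p [Hp lp sp Ep]]].
rewrite (bigD1 w) ?vw ?wu //= big1 ?addr0; last first.
  move=> x /andP[/andP[vx xu] xw]; apply/eqP; apply: contraNT xw.
  case/threat_attained => q [Hq lq sq _]; apply/eqP.
  (* Both walks have length at most [2 * t - 1]; with the two edges at [v] they total at most
     [4 * t]. *)
  apply: (nbwalk_branch adj_sym adj_irr long_cycles vx vw Hq Hp); last by rewrite lp.
  by lia.
rewrite Ep; have [big_p|small_p] := leqP (2 * t.-1) (size p).
  have -> : (size p)./2 = t.-1 by lia.
  by rewrite lerDr mulr_ge0 ?threat_ge0.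
have t_gt1 : (1 < t)%N by lia.
have B0 : 0 < B by apply: lt_le_trans (B_ge1 t_gt1).
have [|||q [Hq lq sq]] := @nbwalk_closed_nbhd T adj adj_sym u v (w :: p) c.
- by rewrite /= vw wu.
- by [].
- by rewrite /= lp.
apply: (@le_trans _ _ (B * B ^- (size p)./2.+1)).
  by rewrite exprS invfM mulrA divff ?gt_eqF // mul1r.
apply: (@le_trans _ _ (B * threat u v c)); last first.
  by rewrite lerDl invr_ge0 exprn_ge0.
rewrite ler_pM2l //; move: sq => /= sq.
apply: le_trans (threat_ge Hq lq _); last by lia.
by apply: le_weight; lia.
Qed.

End Threat.

Lemma min_degree_le (T : finType) (adj : rel T) (x : T) :
  (min_degree adj <= degree adj x)%N.
Proof.
rewrite /min_degree; have : x \in index_enum T by exact: mem_index_enum.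
elim: (index_enum T) => // y s IH; rewrite big_cons inE => /predU1P[<-|/IH].
  exact: geq_minl.
exact/leq_trans/geq_minr.
Qed.

(** * The robber's strategy against few cops *)

Section Evasion.
Variables (R : realType) (T : finType) (adj : rel T).
Hypotheses (adj_sym : symmetric adj) (adj_irr : irreflexive adj).
Variables (t : nat).
Hypothesis (t_gt0 : (0 < t)%N).
Hypothesis (long_cycles : forall p, graph_cycle adj p -> (4 * t < size p)%N).
Variable (B : R).
Hypotheses (B_ge0 : 0 <= B) (B_ge1 : (1 < t)%N -> 1 <= B).
Variables (k q : nat).
Hypotheses (q_gt0 : (0 < q)%N) (q_deg : forall x, (q < degree adj x)%N).
Hypothesis (few_cops : B + k%:R * B ^- t.-1 < q%:R).

Definition danger (u v : T) (c : {ffun 'I_k -> T}) : R :=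
  \sum_i threat adj t B u v (c i).

Lemma danger_ge0 u v c : 0 <= danger u v c.
Proof. by apply: sumr_ge0 => i _; apply: threat_ge0. Qed.

Lemma danger_near u v c i : danger u v c < 1 -> c i != u ->
  v \notin closed_nbhd adj (c i).
Proof.
move=> Hd ciu; apply: contraTN Hd => near; rewrite -leNgt.
have uci : u != c i by rewrite eq_sym.
apply: le_trans (threat_near adj_sym t_gt0 B_ge0 B_ge1 uci near) _.
rewrite /danger (bigD1 i) //= lerDl sumr_ge0 // => j _.
exact: threat_ge0.
Qed.

Lemma exists_step u v (c c' : {ffun 'I_k -> T}) : adj u v ->
  (forall i, c' i \in closed_nbhd adj (c i)) ->
  exists w, [/\ adj v w, w != u &
    q%:R * danger v w c' <= B * danger u v c + k%:R * B ^- t.-1].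
Proof.
move=> uv cc'; set X := _ + _.
pose A := [pred w | adj v w && (w != u)].
have X_ge : \sum_(w in A) danger v w c' <= X.
  rewrite exchange_big /= /X /danger mulr_sumr -[k in k%:R]card_ord mulr_natl.
  rewrite -sumr_const -big_split /=; apply: ler_sum => i _.
  exact: (threat_step adj_sym adj_irr t_gt0 long_cycles B_ge0 B_ge1).

have X_ge0 : 0 <= X by apply: le_trans X_ge; apply: sumr_ge0 => w _; apply: danger_ge0.
(* Only [u] is lost from the more than [q] neighbours of [v]. *)
have A_q : (q <= #|A|)%N.
  have -> : #|A| = (degree adj v).-1.
    rewrite /degree [in RHS](cardD1 u) inE adj_sym uv add1n /=; apply: eq_card => w.
    by rewrite !inE andbC.
  by have := q_deg v; lia.
have [w0 Aw0] : exists w, w \in A by apply/card_gt0P/(leq_trans q_gt0).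
have [w Aw Hw] : exists2 w, w \in A & q%:R * danger v w c' <= X.
  (* Otherwise summing over [A] gives [#|A| * X < q * S] for the total danger [S], against
     [q <= #|A|] and [S <= X]. *)
  apply: contrapT => none.
  have : \sum_(w in A) X < \sum_(w in A) q%:R * danger v w c'.
    apply: ltr_sum => [|w Aw].
      by apply/hasP; exists w0; rewrite ?mem_index_enum.
    by rewrite ltNge; apply/negP => le_w; apply: none; exists w.
  rewrite sumr_const -[X *+ _]mulr_natl -mulr_sumr ltNge => /negP; apply.
  by apply: ler_pM; rewrite ?ler_nat // sumr_ge0 // => w _; apply: danger_ge0.
by exists w; case/andP: Aw.
Qed.

Lemma B_lt_q : B < q%:R.
Proof.
apply: le_lt_trans few_cops; rewrite lerDl mulr_ge0 ?ler0n //.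
by rewrite invr_ge0 exprn_ge0.
Qed.

(** [few_cops] says precisely that the averaged bound, taken at danger 1, stays below 1 after
    division by [q]. *)
Lemma evade_step u v (c c' : {ffun 'I_k -> T}) : adj u v -> danger u v c < 1 ->
  (forall i, c' i \in closed_nbhd adj (c i)) ->
  exists w, [/\ adj v w, w != u & danger v w c' < 1].
Proof.
move=> uv Hd cc'; have [w [vw wu Hw]] := exists_step uv cc'.
exists w; split=> //; rewrite -(@ltr_pM2l _ q%:R) ?ltr0n // mulr1.
apply: le_lt_trans few_cops; apply: le_trans Hw _.
by rewrite lerD2r ler_piMr // ltW.
Qed.

(* At an edge minimising the danger from motionless cops, a further step does
   not decrease it; the averaging bound then forces it below 1. *)
Lemma evade_start (x : T) c : exists u v, adj u v /\ danger u v c < 1.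
Proof.
have /card_gt0P[y] : (0 < degree adj x)%N by apply: leq_ltn_trans (q_deg x).
rewrite inE => xy.
case: (@arg_minP _ R _ (x, y) (fun e => adj e.1 e.2) (fun e => danger e.1 e.2 c)) => //.
move=> [u v] /= uv le_uv; exists u, v; split=> //.
have [||w [vw _ Hw]] := @exists_step u v c c => //.
  by move=> i; rewrite inE eqxx.
have := le_uv (v, w) vw => /= le_vw.
have BD : 0 < q%:R - B by rewrite subr_gt0 B_lt_q.
rewrite -(ltr_pM2l BD) mulr1.
have : q%:R * danger u v c <= q%:R * danger v w c by rewrite ler_pM2l ?ltr0n.
move: few_cops Hw; lra.
Qed.

Lemma danger_free u v c i : adj u v -> danger u v c < 1 -> c i != v.
Proof.
move=> uv Hd; apply/eqP => civ.
have ciu : c i != u by rewrite civ; apply: contraTneq uv => ->; rewrite adj_irr.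
by have := danger_near Hd ciu; rewrite inE civ eqxx.
Qed.

Lemma robber_evades (x : T) : ~ cops_win adj k.
Proof.
case=> sigma [legal win].
(* A state holds the robber's previous vertex, his current vertex, and the history before the
   latter, so [sigma s.2] is the placement the cops are about to change. The last clause excludes a
   cop right behind the robber, a case that [danger_near] does not cover. *)
pose safe (s : T * T * seq T) := [/\ adj s.1.1 s.1.2,
  danger s.1.1 s.1.2 (sigma s.2) < 1 & forall i, sigma s.2 i != s.1.1].
have step (s : T * T * seq T) : exists w, safe s -> safe (s.1.2, w, rcons s.2 s.1.2).
  case: s => [[u v] h]; have [[/= uv Hd Hu]|unsafe] := pselect (safe (u, v, h)).
    have [w [vw _ Hw]] := evade_step uv Hd (fun i => legal h v i).
    exists w => _; split=> //= i; apply/eqP => Hi.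
    by have := danger_near Hd (Hu i); rewrite -[X in X \in _]Hi legal.
  by exists x.
have [next safe_next] := choice step.
(* The robber is placed at [r0], one imaginary step after the edge from [u0] to [v0]: low danger on
   that edge shows [v0] free of cops, as the last clause of [safe] demands initially. *)
have [u0 [v0 [uv0 Hd0]]] := evade_start x (sigma [::]).
have [|r0 [vr0 _ Hr0]] := @evade_step u0 v0 _ (sigma [::]) uv0 Hd0.
  by move=> i; rewrite inE eqxx.
pose state n := iter n (fun s => (s.1.2, next s, rcons s.2 s.1.2)) (v0, r0, [::]).
pose rho n := (state n).1.2.
have safe_state n : safe (state n).
  elim: n => [|n IH]; last exact: safe_next.
  by split=> //= i; apply: danger_free Hd0.
have history n : (state n).2 = mkseq rho n.
  by elim: n => // n IH; rewrite mkseqS -IH.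
have [n|n] := win rho.
  by have [/= + _ _] := safe_state n.+1; rewrite inE => ->; rewrite orbT.
(* Running into a cop contradicts low danger at [n]; being caught by the answer contradicts the last
   clause of [safe] at [n.+1]. *)
case=> [[i]|[i]]; rewrite -history => /eqP.
  have [+ + _] := safe_state n => adj_n danger_n.
  by apply/negP/(danger_free _ adj_n danger_n).
by have [_ _ /(_ i)/negP] := safe_state n.+1.
Qed.

End Evasion.

(** * Numerical estimates and the bound on the cop number *)

Lemma expR1_gt1 (R : realType) : 1 < expR 1 :> R.
Proof. by have := @expR_gt1Dx R 1 (oner_neq0 R); lra. Qed.

(** For positive [n] the inverse ratio is [1 + 1/n], which is less than [expR (1/n)]; for [n = 0]
    the power is 1. *)
Lemma expR1_mul_ratio_gt1 (R : realType) (n : nat) :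
  1 < expR 1 * (n%:R / n.+1%:R) ^+ n :> R.
Proof.
case: n => [|n]; first by rewrite expr0 mulr1 expR1_gt1.
set x : R := _ / _.
have n0 : n.+1%:R != 0 :> R by rewrite pnatr_eq0.
have x_gt0 : 0 < x by rewrite divr_gt0 ?ltr0n.
have xV : x^-1 = 1 + n.+1%:R^-1.
  by rewrite invf_div -(natr1 n.+1) mulrDl divff // mul1r.
rewrite -ltr_pdivrMr ?exprn_gt0 // mul1r -exprVn xV.
have -> : expR 1 = expR (n.+1%:R^-1) ^+ n.+1 :> R.
  by rewrite -expRM_natl divff.
rewrite ltrXn2r ?nnegrE ?expR_ge0 ?addr_ge0 ?invr_ge0 ?ler0n //.
by rewrite expR_gt1Dx ?invr_neq0.
Qed.

Lemma cops_win_gt0 (T : finType) (adj : rel T) (k : nat) (x : T) :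
  cops_win adj k -> (0 < k)%N.
Proof.
case: k => // -[sigma [_ /(_ (fun=> x))]].
by case=> [n|n [[[]]|[[]]]] //; rewrite inE eqxx.
Qed.

Lemma girth_le_size (R : realType) (T : finType) (adj : rel T) p :
  graph_cycle adj p -> (girth R adj <= (size p)%:R%:E)%E.
Proof. by move=> Hp; apply: ereal_inf_lbound; exists p. Qed.

Theorem theorem1p1 (R : realType) (T : finType) (adj : rel T)
    (adj_sym : symmetric adj) (adj_irr : irreflexive adj)
    (adj_conn : graph_connected adj)
    (t : nat) (t_ge1 : (1 <= t)%N)
    (girth_ge : (((4 * t + 1)%N%:R)%:E <= girth R adj)%E) :
  (cop_number adj)%:R
    > 1 / (expR 1 * t%:R) * ((min_degree adj)%:R - 1) ^+ t :> R.
Proof.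
have [x _] : exists x : T, x \in T by apply/card_gt0P; case: adj_conn.
rewrite /cop_number; case: ex_minnP => k /asboolP wins _.
case: t t_ge1 girth_ge => // n _ girth_ge.
have long_cycles p : graph_cycle adj p -> (4 * n.+1 < size p)%N.
  move=> /(girth_le_size R)/(le_trans girth_ge).
  by rewrite lee_fin ler_nat addn1.
have e_gt1 := expR1_gt1 R.
(* In the small case the claimed bound is below 1. Otherwise [q] is at least 2, which yields
   [1 <= B] when [t > 1]. *)
have [small|large] := leqP (min_degree adj) 2.
  apply: (@lt_le_trans _ _ 1); last by rewrite ler1n (cops_win_gt0 x wins).
  have : ((min_degree adj)%:R - 1) ^+ n.+1 <= 1 :> R.
    apply: le_trans (ler_norm _) _; rewrite normrX exprn_ile1 //.
    have : (min_degree adj)%:R <= 2 :> R by rewrite ler_nat.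
    by rewrite ler_norml; have := ler0n R (min_degree adj); lra.
  have et_gt1 : 1 < expR 1 * n.+1%:R :> R.
    by apply: (lt_le_trans e_gt1); rewrite ler_peMr ?expR_ge0 // ler1n.
  move=> pow_le1; apply: (@le_lt_trans _ _ (1 / (expR 1 * n.+1%:R))).
    by rewrite ler_piMr // divr_ge0 // (le_trans ler01) // ltW.
  by rewrite ltr_pdivrMr ?mul1r // (lt_trans ltr01).
rewrite ltNge; apply/negP => few.
have [q Eq q_gt1] : exists2 q, min_degree adj = q.+1 & (1 < q)%N.
  by exists (min_degree adj).-1; lia.
have q_gt0 : (0 < q)%N by exact: ltnW.
rewrite Eq -(natr1 q) addrK in few.
(* [few_cops] amounts to [k < (q - B) * B ^+ n], and this [B] maximises the right-hand side. *)
pose rho : R := n%:R / n.+1%:R; pose B := rho * q%:R.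
have rho_ge0 : 0 <= rho by rewrite divr_ge0.
apply: (@robber_evades R T adj adj_sym adj_irr n.+1 _ long_cycles B _ _ k q _ _ _ x wins) => //.
- by rewrite mulr_ge0.
- move=> n_gt0; rewrite /B /rho mulrAC -natrM ler_pdivlMr ?ltr0n // mul1r ler_nat.
  by nia.
- by move=> y; apply: leq_trans (min_degree_le adj y); rewrite Eq.
have e_rho : 1 < expR 1 * rho ^+ n := expR1_mul_ratio_gt1 R n.
have e0 : 0 < expR 1 :> R := expR_gt0 1.
have rhoX : 0 < rho ^+ n by rewrite -(pmulr_rgt0 _ e0) (lt_trans ltr01).
have t0 : 0 < n.+1%:R :> R by rewrite ltr0n.
have q0 : 0 < q%:R :> R by rewrite ltr0n.
have BX : 0 < B ^+ n by rewrite exprMn mulr_gt0 // exprn_gt0.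
have -> : q%:R = B + q%:R / n.+1%:R :> R.
  by rewrite /B /rho -(natr1 n); field; rewrite natr1 gt_eqF.
rewrite ltrD2l ltr_pdivrMr //; apply: le_lt_trans few _.
(* The admissible number of cops exceeds the bound in [few] by the factor [expR 1 * rho ^+ n], which
   is greater than 1. *)
have -> : q%:R / n.+1%:R * B ^+ n
    = 1 / (expR 1 * n.+1%:R) * q%:R ^+ n.+1 * (expR 1 * rho ^+ n).
  by rewrite /B exprMn exprS; field; rewrite !gt_eqF.
by rewrite ltr_pMr // mulr_gt0 ?exprn_gt0 // divr_gt0 // mulr_gt0.
Qed.
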